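(* Let $(\mathbf{C},I)$ be a substate-separated $\sigma$-effectus with scalars $\mathbf{C}(I,I)\cong\{0,1\}$. Then there is a faithful morphism of $\sigma$-effectuses $G\colon\mathbf{C}\to\boldsymbol{\omega}\mathbf{BA}^{\mathrm{op}}$.
   Context: Countable means finite (possibly empty) or countably infinite. A partial commutative monoid (PCM) is a set $X$ with $0\in X$ and a partial binary operation $\oplus$ with $(x\oplus y)\oplus z=x\oplus(y\oplus z)$, $x\oplus y=y\oplus x$, $0\oplus x=x$, where ''$=$'' is Kleene equality (if either side is defined, so is the other, and they are equal); $x\perp y$ means $x\oplus y$ is defined. An effect algebra is a PCM $E$ with an element $1\in E$ such that for each $a\in E$ there is a unique $a^{\perp}\in E$ with $a\oplus a^{\perp}=1$, and $a\perp 1$ implies $a=0$; it is partially ordered by $a\le b$ iff $a\oplus c=b$ for some $c$. A $\sigma$-PAM is a nonempty set $M$ with a partial operation $\bigoplus$ sending countable families $(x_j)_{j\in J}$ in $M$ to elements of $M$ (a family is summable if its sum is defined), such that: (partition-associativity) for each countable family $(x_j)_{j\in J}$ and countable partition $J=\biguplus_{k\in K}J_k$, the family is summable iff each $(x_j)_{j\in J_k}$ is summable and $(\bigoplus_{j\in J_k}x_j)_{k\in K}$ is summable, and then $\bigoplus_{j\in J}x_j=\bigoplus_{k\in K}\bigoplus_{j\in J_k}x_j$; (unary sum) one-element families are summable with sum their element; (limit) a countable family is summable whenever all its finite subfamilies are. A $\sigma$-PAM is a PCM with $x_1\oplus x_2=\bigoplus_{i\in\{1,2\}}x_i$ and $0=\bigoplus\emptyset$.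 A map between $\sigma$-PAMs is $\sigma$-additive if it sends summable families to summable families and preserves their sums; $\sigma$-biadditive means $\sigma$-additive in each argument. A $\sigma$-PAC is a category $\mathbf{C}$ with countable coproducts (coprojections $\kappa_i$), all of whose homsets are $\sigma$-PAMs with $\sigma$-biadditive composition (so there are zero morphisms $0_{AB}$), such that: (compatible sum) every compatible countable family $(f_j\colon A\to B)_{j\in J}$ is summable in $\mathbf{C}(A,B)$; (untying) if $f,g\colon A\to B$ are summable then so are $\kappa_1\circ f,\kappa_2\circ g\colon A\to B+B$. Here $(f_j\colon A\to B_j)_{j\in J}$ is compatible if there is $f\colon A\to\coprod_{j}B_j$ with $\triangleright_j\circ f=f_j$ for all $j$, where the partial projection $\triangleright_i\colon\coprod_jB_j\to B_i$ is determined by $\triangleright_i\circ\kappa_i=\mathrm{id}$ and $\triangleright_i\circ\kappa_k=0$ for $k\ne i$. A $\sigma$-effectus is a $\sigma$-PAC $\mathbf{C}$ with a distinguished object $I$ such that: (i) for each $A$, the PCM $\mathbf{C}(A,I)$ is an effect algebra, with top written $\mathbf{1}_A$; (ii) $\mathbf{1}_B\circ f=0_{AI}$ implies $f=0_{AB}$ for all $f\colon A\to B$; (iii) $\mathbf{1}_B\circ f\perp\mathbf{1}_B\circ g$ implies $f\perp g$ for all $f,g\colon A\to B$. A morphism of $\sigma$-effectuses $(\mathbf{C},I_{\mathbf{C}})\to(\mathbf{D},I_{\mathbf{D}})$ is a functor $F\colon\mathbf{C}\to\mathbf{D}$ that preserves countable coproducts and for which there is an isomorphism $u\colon I_{\mathbf{D}}\to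 FI_{\mathbf{C}}$ with $F\mathbf{1}_A=u\circ\mathbf{1}_{FA}$ for each $A\in\mathbf{C}$; it is called faithful if it is faithful as a functor. A substate on $A$ is a morphism $\omega\colon I\to A$. The $\sigma$-effectus is substate-separated if for any $f,g\colon A\to B$ one has $f=g$ whenever $f\circ\omega=g\circ\omega$ for all substates $\omega$ on $A$. The scalars $\mathbf{C}(I,I)$ form an effect monoid (an effect algebra with an associative, unital (with unit $1$), biadditive total multiplication) under composition; $\mathbf{C}(I,I)\cong\{0,1\}$ means isomorphism with the two-element effect monoid. $\boldsymbol{\omega}\mathbf{BA}$ is the category of $\omega$-complete Boolean algebras (equivalently, Boolean algebras with all countable joins) and functions that preserve countable joins (including the empty join $0$) and nonempty countable meets (so the top need not be preserved). Its opposite is a $\sigma$-effectus with unit object the two-element Boolean algebra $\{0,1\}$: the map $\mathbf{1}_B$ is the function $\{0,1\}\to B$ with $0\mapsto0$, $1\mapsto1$; a countable family of parallel maps $f_j\colon B\to B'$ of $\boldsymbol{\omega}\mathbf{BA}$ is summable iff the elements $f_j(1)$ are pairwise disjoint, with sum the pointwise join. *)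

(* Defs.v *)
From HB Require Import structures.
From mathcomp Require Import all_boot all_order.
From mathcomp Require Import boolp classical_sets.

Set Implicit Arguments.
Unset Strict Implicit.
Unset Printing Implicit Defensive.

Import Order.Theory.

Declare Scope cat_scope.
Delimit Scope cat_scope with cat.
Local Open Scope classical_set_scope.
Local Open Scope order_scope.
Local Open Scope cat_scope.

(* A partial operation is a function into an option type, so that Kleene
   equality is equality of options. *)
Record PCM (M : Type) := {
  padd : M -> M -> option M;
  pzero : M;
  paddA : forall x y z,
    obind (fun s => padd s z) (padd x y) = obind (padd x) (padd y z);
  paddC : forall x y, padd x y = padd y x;
  padd0 : forall x, padd pzero x = Some x
}.

Definition orth M (P : PCM M) (x y : M) : Prop := isSome (padd P x y).

Definition is_effect_algebra M (P : PCM M) (one : M) : Prop :=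
  (forall a, exists! b, padd P a b = Some one) /\
  (forall a, orth P a one -> a = pzero P).

Record effectMonoid (M : Type) := {
  em_pcm : PCM M;
  em_one : M;
  em_effect : is_effect_algebra em_pcm em_one;
  em_mul : M -> M -> M;
  em_mulA : associative em_mul;
  em_mul1m : left_id em_one em_mul;
  em_mulm1 : right_id em_one em_mul;
  em_mulDl : forall x y s z, padd em_pcm x y = Some s ->
    padd em_pcm (em_mul x z) (em_mul y z) = Some (em_mul s z);
  em_mulDr : forall z x y s, padd em_pcm x y = Some s ->
    padd em_pcm (em_mul z x) (em_mul z y) = Some (em_mul z s)
}.

Definition em_isomorphic M N (E : effectMonoid M) (F : effectMonoid N) : Prop :=
  exists phi : M -> N,
    [/\ bijective phi,
        phi (pzero (em_pcm E)) = pzero (em_pcm F),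
        phi (em_one E) = em_one F,
        (forall x y, omap phi (padd (em_pcm E) x y) =
                     padd (em_pcm F) (phi x) (phi y)) &
        (forall x y, phi (em_mul E x y) = em_mul F (phi x) (phi y))].

Definition two_pcm : PCM bool.
Proof.
apply: (@Build_PCM bool (fun x y => if x && y then None else Some (x || y)) false).
- by do 3 case.
- by do 2 case.
- by case.
Defined.

Definition two_em : effectMonoid bool.
Proof.
apply: (@Build_effectMonoid bool two_pcm true _ andb).
- split; last by case.
  by case; [exists false|exists true]; split => //; case.
- exact: andbA.
- exact: andTb.
- exact: andbT.
- by do 4 case.
- by do 4 case.
Defined.

(* Countable families are indexed by a countType.  The partition of J into the
   blocks J_k is given by the map p sending each j to the k with j in J_k; some
   blocks may be empty.  The last axiom ranges over finite subfamilies, given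
   by finite lists of indices. *)
Record sigmaPAM (M : Type) := {
  psum : forall J : countType, (J -> M) -> option M;
  psum_inhabited : inhabited M;
  psum_partition : forall (J K : countType) (p : J -> K) (x : J -> M) (s : M),
    psum x = Some s <->
    exists2 y : K -> M,
      (forall k, psum (fun j : {j : J | p j == k} => x (val j)) = Some (y k)) &
      psum y = Some s;
  psum_unary : forall (J : countType) (x : J -> M) (j0 : J),
    (forall j, j = j0) -> psum x = Some (x j0);
  psum_limit : forall (J : countType) (x : J -> M),
    (forall t : seq J, isSome (psum (fun j : {j : J | j \in t} => x (val j)))) ->
    isSome (psum x)
}.

Definition summable M (S : sigmaPAM M) (J : countType) (x : J -> M) : Prop :=
  isSome (psum S x).

Section SigmaPAMtoPCM.
Variables (M : Type) (S : sigmaPAM M).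

Lemma psum_reindex (J K : countType) (phi : J -> K) (x : K -> M) :
  bijective phi -> psum S (x \o phi) = psum S x.
Proof.
case=> psi phiK psiK.
have fib k : psum S (fun j : {j | phi j == k} => (x \o phi) (val j)) = Some (x k).
  have j0P : phi (psi k) == k by rewrite psiK.
  rewrite (@psum_unary _ S _ _ (exist _ (psi k) j0P)) /= ?psiK //.
  by case=> j jP; apply: val_inj => /=; rewrite -(eqP jP) phiK.
have H s : psum S (x \o phi) = Some s <-> psum S x = Some s.
  split=> [/(psum_partition S phi) [y yP <-]|xs].
    by congr psum; apply: funext => k; apply: Some_inj; rewrite -fib yP.
  by apply/(psum_partition S phi); exists x.
case E : (psum S x) => [s|]; first by apply/H.
by case E' : (psum S _) => [s|//]; move/H: E'; rewrite E.
Qed.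

Lemma psum_void : isSome (psum S (of_void M)).
Proof.
case: (psum_inhabited S) => m.
have u := @psum_unary _ S _ (fun _ : unit => m) tt.
have {u} /(psum_partition S (fun=> true)) [y yP _] := u ltac:(by case).
pose phi (v : void) : {j : unit | true == false} := of_void _ v.
have bphi : bijective phi by exists (fun j => False_rect _ (notF (valP j))); case.
have := yP false; rewrite -(psum_reindex _ bphi) => h.
by rewrite (_ : of_void M = (fun=> m) \o phi) ?h //; apply: funext; case.
Qed.

Definition psum_empty : {z | psum S (of_void M) = Some z}.
Proof. by case: (psum S _) psum_void => // z _; exists z. Defined.

Let add x y := psum S (fun b : bool => if b then x else y).

Lemma psum_sum (A B : countType) (x : A + B -> M) :
  psum S x = obind (fun a => obind (add a) (psum S (x \o inr))) (psum S (x \o inl)).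
Proof.
pose p (j : A + B) := if j is inl _ then true else false.
have L : psum S (fun j : {j | p j == true} => x (val j)) = psum S (x \o inl).
  pose f (a : A) : {j | p j == true} := exist _ (inl a) (eqxx _).
  rewrite -(psum_reindex (phi := f)) //.
  exists (fun j => match val j as v return p v == true -> A with
                   inl a => fun=> a | inr b => fun h => False_rect A (notF h) end (valP j)) => //.
  by case=> [[a|b]] h //; apply: val_inj.
have R : psum S (fun j : {j | p j == false} => x (val j)) = psum S (x \o inr).
  pose f (b : B) : {j | p j == false} := exist _ (inr b) (eqxx _).
  rewrite -(psum_reindex (phi := f)) //.
  exists (fun j => match val j as v return p v == false -> B with
                   inl a => fun h => False_rect B (notF h) | inr b => fun=> b end (valP j)) => //.
  by case=> [[a|b]] h //; apply: val_inj.
have H s : psum S x = Some s <->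
    obind (fun a => obind (add a) (psum S (x \o inr))) (psum S (x \o inl)) = Some s.
  rewrite (psum_partition S p); split.
    case=> y yP ys; rewrite -L -R !yP /= /add -ys; congr psum.
    by apply: funext; case.
  case El : (psum S (x \o inl)) => [a|//]; case Er : (psum S (x \o inr)) => [b|//] /= h.
  by exists (fun c : bool => if c then a else b) => //; case; rewrite ?L ?R.
case E : (psum S x) => [s|]; first by apply/esym/H.
by case E' : (obind _ _) => [s|//]; move/H: E'; rewrite E.
Qed.

Let zero : M := sval psum_empty.

Let psum1 (x : unit -> M) : psum S x = Some (x tt).
Proof. by apply: psum_unary; case. Qed.

Lemma sigmaPAM_addC x y : add x y = add y x.
Proof.
rewrite /add -(psum_reindex (phi := negb)); last by exists negb; case.
by congr psum; apply: funext; case.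
Qed.

Lemma sigmaPAM_add0 x : add zero x = Some x.
Proof.
pose f (j : void + unit) := if j is inr _ then x else zero.
have := psum_sum f; rewrite (_ : f \o inl = of_void M); last by apply: funext; case.
rewrite psum1 (svalP psum_empty) /= => <-; rewrite (@psum_unary _ S _ _ (inr tt)) //.
by case=> [[]|[]].
Qed.

Lemma sigmaPAM_addA x y z :
  obind (fun s => add s z) (add x y) = obind (add x) (add y z).
Proof.
pose f (j : bool + unit) := match j with inl b => if b then x else y | inr _ => z end.
pose g (j : unit + bool) := match j with inl _ => x | inr b => if b then y else z end.
pose phi (j : bool + unit) : unit + bool :=
  match j with inl true => inl tt | inl false => inr true | inr _ => inr false end.
pose psi (j : unit + bool) : bool + unit :=
  match j with inl _ => inl true | inr true => inl false | inr false => inr tt end.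
have bphi : bijective phi by exists psi; [move=> [[]|[]]|move=> [[]|[]]].
have := psum_reindex g bphi; rewrite (_ : g \o phi = f); last by apply: funext; move=> [[]|[]].
by rewrite !psum_sum !psum1.
Qed.

Definition sigmaPAM_PCM : PCM M :=
  Build_PCM sigmaPAM_addA sigmaPAM_addC sigmaPAM_add0.

End SigmaPAMtoPCM.

Record category := {
  ob :> Type;
  hom : ob -> ob -> Type;
  idm : forall A, hom A A;
  comp : forall A B C, hom B C -> hom A B -> hom A C;
  compA : forall A B C D (h : hom C D) (g : hom B C) (f : hom A B),
    comp h (comp g f) = comp (comp h g) f;
  comp1m : forall A B (f : hom A B), comp (idm B) f = f;
  compm1 : forall A B (f : hom A B), comp f (idm A) = f
}.

Notation "g ∘ f" := (comp g f) (at level 40, left associativity) : cat_scope.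

Definition opcat (C : category) : category :=
  {| ob := C;
     hom A B := hom B A;
     idm A := idm A;
     comp _ _ _ g f := f ∘ g;
     compA _ _ _ _ h g f := esym (compA f g h);
     comp1m _ _ f := compm1 f;
     compm1 _ _ f := comp1m f |}.

Definition is_iso (C : category) (A B : C) (u : hom A B) : Prop :=
  exists v : hom B A, v ∘ u = idm A /\ u ∘ v = idm B.

Definition is_coproduct (C : category) (J : countType) (B : J -> C) (P : C)
    (kappa : forall j, hom (B j) P) : Prop :=
  forall (X : C) (f : forall j, hom (B j) X),
    exists! h : hom P X, forall j, h ∘ kappa j = f j.

(* The choice of coproducts is immaterial: preservation is stated for every
   coproduct cocone. *)
Record countable_coproducts (C : category) := {
  coprod : forall J : countType, (J -> C) -> C;
  coproj : forall (J : countType) (B : J -> C) (j : J), hom (B j) (coprod B);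
  coprodP : forall (J : countType) (B : J -> C), is_coproduct (coproj B)
}.

Record functor (C D : category) := {
  fobj :> C -> D;
  fmap : forall A B, hom A B -> hom (fobj A) (fobj B);
  fmap1 : forall A, fmap (idm A) = idm (fobj A);
  fmapM : forall A B E (g : hom B E) (f : hom A B),
    fmap (g ∘ f) = fmap g ∘ fmap f
}.

Definition faithful (C D : category) (F : functor C D) : Prop :=
  forall (A B : C) (f g : hom A B), fmap F f = fmap F g -> f = g.

Definition preserves_countable_coproducts (C D : category) (F : functor C D) :
    Prop :=
  forall (J : countType) (B : J -> C) (P : C) (kappa : forall j, hom (B j) P),
    is_coproduct kappa -> is_coproduct (fun j => fmap F (kappa j)).

Section Compatible.
Variables (C : category) (cc : countable_coproducts C).
Variable hs : forall A B : C, sigmaPAM (hom A B).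

(* The two equations determine p, as the family coproj is jointly epic. *)
Definition is_pproj (J : countType) (B : J -> C) (i : J)
    (p : hom (coprod cc B) (B i)) : Prop :=
  p ∘ coproj cc B i = idm (B i) /\
  forall k, k != i -> p ∘ coproj cc B k = pzero (sigmaPAM_PCM (hs (B k) (B i))).

Definition compatible (A : C) (J : countType) (B : J -> C)
    (f : forall j, hom A (B j)) : Prop :=
  exists h : hom A (coprod cc B),
    forall j, exists2 p : hom (coprod cc B) (B j), is_pproj p & p ∘ h = f j.

End Compatible.

(* The binary coproduct B + B is the one indexed by bool, with true for the
   first summand. *)
Record sigmaPAC := {
  pac_cat :> category;
  pac_coprod : countable_coproducts pac_cat;
  pac_hom : forall A B : pac_cat, sigmaPAM (hom A B);
  comp_psumr : forall (A B C : pac_cat) (g : hom B C) (J : countType)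
      (f : J -> hom A B) (s : hom A B),
    psum (pac_hom A B) f = Some s ->
    psum (pac_hom A C) (fun j => g ∘ f j) = Some (g ∘ s);
  comp_psuml : forall (A B C : pac_cat) (f : hom A B) (J : countType)
      (g : J -> hom B C) (s : hom B C),
    psum (pac_hom B C) g = Some s ->
    psum (pac_hom A C) (fun j => g j ∘ f) = Some (s ∘ f);
  compatible_sum : forall (A B : pac_cat) (J : countType) (f : J -> hom A B),
    compatible pac_coprod pac_hom (B := fun=> B) f -> summable (pac_hom A B) f;
  untying : forall (A B : pac_cat) (f g : hom A B),
    let kappa := coproj pac_coprod (fun _ : bool => B) in
    orth (sigmaPAM_PCM (pac_hom A B)) f g ->
    orth (sigmaPAM_PCM (pac_hom A _)) (kappa true ∘ f) (kappa false ∘ g)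
}.

Definition hom_pcm (C : sigmaPAC) (A B : C) : PCM (hom A B) :=
  sigmaPAM_PCM (pac_hom A B).

Definition zerom (C : sigmaPAC) (A B : C) : hom A B := pzero (hom_pcm A B).

Record sigmaEffectus := {
  eff_pac :> sigmaPAC;
  eff_I : eff_pac;
  eff_one : forall A : eff_pac, hom A eff_I;
  eff_effect : forall A, is_effect_algebra (hom_pcm A eff_I) (eff_one A);
  eff_zero : forall (A B : eff_pac) (f : hom A B),
    eff_one B ∘ f = zerom A eff_I -> f = zerom A B;
  eff_orth : forall (A B : eff_pac) (f g : hom A B),
    orth (hom_pcm A eff_I) (eff_one B ∘ f) (eff_one B ∘ g) ->
    orth (hom_pcm A B) f g
}.

Arguments eff_I : clear implicits.

Definition is_effectus_morphism (C D : sigmaEffectus) (F : functor C D) : Prop :=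
  preserves_countable_coproducts F /\
  exists2 u : hom (eff_I D) (F (eff_I C)), is_iso u &
    forall A : C, fmap F (eff_one A) = u ∘ eff_one (F A).

Definition substate (C : sigmaEffectus) (A : C) : Type := hom (eff_I C) A.

Definition substate_separated (C : sigmaEffectus) : Prop :=
  forall (A B : C) (f g : hom A B),
    (forall w : substate A, f ∘ w = g ∘ w) -> f = g.

Section Scalars.
Variable C : sigmaEffectus.
Let I := eff_I C.

Lemma comp_paddr (A B D : C) (g : hom B D) (x y s : hom A B) :
  padd (hom_pcm A B) x y = Some s -> padd (hom_pcm A D) (g ∘ x) (g ∘ y) = Some (g ∘ s).
Proof.
move=> /(comp_psumr g) <-; rewrite /= ; congr psum; by apply: funext; case.
Qed.

Lemma comp_paddl (A B D : C) (f : hom A B) (x y s : hom B D) :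
  padd (hom_pcm B D) x y = Some s -> padd (hom_pcm A D) (x ∘ f) (y ∘ f) = Some (s ∘ f).
Proof.
move=> /(comp_psuml f) <-; rewrite /= ; congr psum; by apply: funext; case.
Qed.

Lemma eff_one_I : eff_one I = idm I.
Proof.
have [s [sP _]] := (eff_effect I).1 (idm I).
have := comp_paddr (eff_one I) sP; rewrite compm1 paddC => o1.
have s0 : s = zerom I I.
  apply: eff_zero; apply: (eff_effect I).2; by rewrite /orth o1.
move: sP; rewrite s0 paddC padd0; by case.
Qed.

Lemma scalar_mul1m : left_id (eff_one I) (@comp C I I I).
Proof. by move=> x; rewrite eff_one_I comp1m. Qed.

Lemma scalar_mulm1 : right_id (eff_one I) (@comp C I I I).
Proof. by move=> x; rewrite eff_one_I compm1. Qed.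

Definition scalars : effectMonoid (hom I I) :=
  {| em_effect := eff_effect I;
     em_mul := @comp C I I I;
     em_mulA := @compA C I I I I;
     em_mul1m := scalar_mul1m;
     em_mulm1 := scalar_mulm1;
     em_mulDl := fun x y s z => @comp_paddl I I I z x y s;
     em_mulDr := fun z x y s => @comp_paddr I I I z x y s |}.

End Scalars.

(* A ctbDistrLatticeType is a Boolean algebra, possibly with \bot = \top. *)
Record omegaBA := {
  oba_disp : Order.disp_t;
  oba_sort :> ctbDistrLatticeType oba_disp;
  oba_join : forall (J : countType) (u : J -> oba_sort),
    supremums (range u) !=set0
}.

(* J may be empty for joins but not for meets, so that \bot is preserved whereas
   \top need not be. *)
Record omegaBA_hom (A B : omegaBA) := {
  ohom_fun :> A -> B;
  ohom_join : forall (J : countType) (u : J -> A) (s : A),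
    supremums (range u) s -> supremums (range (ohom_fun \o u)) (ohom_fun s);
  ohom_meet : forall (J : countType) (j0 : J) (u : J -> A) (m : A),
    infimums (range u) m -> infimums (range (ohom_fun \o u)) (ohom_fun m)
}.

Lemma ohom_ext (A B : omegaBA) (f g : omegaBA_hom A B) : (forall a, f a = g a) -> f = g.
Proof.
case: f g => f f1 f2 [g g1 g2] /= /funext E; case: _ / E g1 g2 => g1 g2.
by congr Build_omegaBA_hom; exact: Prop_irrelevance.
Qed.

Lemma supremumsP d (T : porderType d) (J : Type) (u : J -> T) (s : T) :
  supremums (range u) s <-> (forall y, s <= y <-> forall j, u j <= y).
Proof.
split=> [[us sl] y|H]; last first.
  split=> [_ [j _ <-]|y yP]; first exact: (H s).1.
  by apply/H => j; apply: yP; exists j.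
split=> [sy j|uy]; first by apply: le_trans sy; apply: us; exists j.
by apply: sl => _ [j _ <-].
Qed.

Lemma infimumsP d (T : porderType d) (J : Type) (u : J -> T) (s : T) :
  infimums (range u) s <-> (forall y, y <= s <-> forall j, y <= u j).
Proof.
split=> [[us sl] y|H]; last first.
  split=> [_ [j _ <-]|y yP]; first exact: (H s).1.
  by apply/H => j; apply: yP; exists j.
split=> [sy j|uy]; first by apply: (le_trans sy); apply: us; exists j.
by apply: sl => _ [j _ <-].
Qed.

Definition cjoin (A : omegaBA) (J : countType) (u : J -> A) : A :=
  supremum \bot (range u).

Section Cjoin.
Variable A : omegaBA.
Implicit Types (J K : countType) (x y a b : A).

Lemma cjoin_sup J (u : J -> A) : supremums (range u) (cjoin u).
Proof.
have [s sP] := oba_join u; rewrite /cjoin /supremum; case: ifPn => [/eqP E|_].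
  by rewrite E; split=> [? []|? _]; exact: le0x.
exact: (xgetI _ sP).
Qed.

Lemma cjoinP J (u : J -> A) y : cjoin u <= y <-> forall j, u j <= y.
Proof. exact: (supremumsP _ _).1 (cjoin_sup u) y. Qed.

Lemma cjoin_ub J (u : J -> A) j : u j <= cjoin u.
Proof. exact: (cjoinP u _).1. Qed.

Lemma supremums_cjoin J (u : J -> A) s : supremums (range u) s <-> s = cjoin u.
Proof.
split=> [/supremumsP H|->]; last exact: cjoin_sup.
apply/eqP; rewrite eq_le; apply/andP; split; first exact/H/cjoin_ub.
by apply/cjoinP/H.
Qed.

Lemma meet_le_imp x y a : (x `&` y <= a) = (x <= a `|` ~` y).
Proof. by rewrite -{1}[y]complK -diffE leBLR joinC. Qed.

Lemma cjoin_meet J (u : J -> A) b : cjoin u `&` b = cjoin (fun j => u j `&` b).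
Proof.
apply/eqP; rewrite eq_le; apply/andP; split.
  rewrite meet_le_imp; apply/cjoinP => j.
  by rewrite -meet_le_imp cjoin_ub.
by apply/cjoinP => j; rewrite leI2 // cjoin_ub.
Qed.

Lemma cjoin_partition J K (p : J -> K) (u : J -> A) :
  cjoin u = cjoin (fun k => cjoin (fun j : {j | p j == k} => u (val j))).
Proof.
apply/eqP; rewrite eq_le; apply/andP.
split; [apply/cjoinP => j|apply/cjoinP => k].
  apply: le_trans (cjoin_ub _ (p j)).
  exact: (cjoin_ub (fun i : {i | p i == p j} => u (val i)) (exist _ j (eqxx _))).
by apply/cjoinP => j; exact: cjoin_ub.
Qed.

Lemma cjoin_single J (u : J -> A) j0 : (forall j, j = j0) -> cjoin u = u j0.
Proof.
move=> H; apply/eqP; rewrite eq_le cjoin_ub andbT; apply/cjoinP => j.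
by rewrite (H j).
Qed.

Lemma cjoin_disj J K (u : J -> A) (v : K -> A) :
  (forall i j, u i `&` v j = \bot) -> cjoin u `&` cjoin v = \bot.
Proof.
move=> H; apply/eqP; rewrite -lex0 cjoin_meet; apply/cjoinP => i.
by rewrite meetC cjoin_meet; apply/cjoinP => j; rewrite meetC H.
Qed.

Lemma cjoin_bool (u : bool -> A) : cjoin u = u true `|` u false.
Proof.
apply/eqP; rewrite eq_le leUx !cjoin_ub !andbT.
by apply/cjoinP; case; rewrite ?leUl ?leUr.
Qed.

Lemma cjoin_void J (u : J -> A) : (J -> False) -> cjoin u = \bot.
Proof. by move=> H; apply/eqP; rewrite -lex0; apply/cjoinP => j; case: (H j). Qed.

Lemma disj_le x y x' y' : x <= x' -> y <= y' -> x' `&` y' = \bot -> x `&` y = \bot.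
Proof. by move=> h h' E; apply/eqP; rewrite -lex0 -E leI2. Qed.

End Cjoin.

Section OhomTheory.
Variables (A B : omegaBA) (f : omegaBA_hom A B).

Lemma ohom_cjoin (J : countType) (u : J -> A) : f (cjoin u) = cjoin (f \o u).
Proof. exact/supremums_cjoin/ohom_join/cjoin_sup. Qed.

Lemma ohom0 : f \bot = \bot.
Proof.
have v : void -> False by case.
by rewrite -(cjoin_void (of_void A) v) ohom_cjoin cjoin_void.
Qed.

Lemma ohomU x y : f (x `|` y) = f x `|` f y.
Proof.
have := ohom_cjoin (fun b : bool => if b then x else y).
by rewrite !cjoin_bool.
Qed.

Lemma ohom_le x y : x <= y -> f x <= f y.
Proof. by move=> /join_idPl <-; rewrite ohomU leUr. Qed.

Lemma ohomI x y : f (x `&` y) = f x `&` f y.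
Proof.
have i1 : infimums (range (fun b : bool => if b then x else y)) (x `&` y).
  apply/infimumsP => z; rewrite lexI; split=> [/andP[zx zy] []//|zb].
  by rewrite (zb true) (zb false).
have /infimumsP H := ohom_meet f true i1.
apply/eqP; rewrite eq_le lexI !ohom_le ?leIl ?leIr //=.
by apply/H; case; rewrite /= ?leIl ?leIr.
Qed.

Lemma ohom_disj x y : x `&` y = \bot -> f x `&` f y = \bot.
Proof. by move=> E; rewrite -ohomI E ohom0. Qed.

End OhomTheory.

Definition omegaBA_id (A : omegaBA) : omegaBA_hom A A.
Proof. by apply: (@Build_omegaBA_hom A A id). Defined.

Definition omegaBA_comp (A B D : omegaBA) (g : omegaBA_hom B D)
  (f : omegaBA_hom A B) : omegaBA_hom A D.
Proof.
apply: (@Build_omegaBA_hom A D (g \o f)) => [J u s us|J j0 u m um].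
  exact: (ohom_join g (ohom_join f us)).
exact: (ohom_meet g j0 (ohom_meet f j0 um)).
Defined.

Definition omegaBA_cat : category.
Proof.
apply: (@Build_category omegaBA omegaBA_hom omegaBA_id omegaBA_comp).
- by move=> *; apply: ohom_ext.
- by move=> *; apply: ohom_ext.
- by move=> *; apply: ohom_ext.
Defined.

Definition odisjoint (A B : omegaBA) (J : countType)
    (f : J -> omegaBA_hom A B) : Prop :=
  forall i j, i != j -> f i \top `&` f j \top = \bot.

Definition ojoin (A B : omegaBA) (J : countType) (f : J -> omegaBA_hom A B)
  (D : odisjoint f) : omegaBA_hom A B.
Proof.
apply: (@Build_omegaBA_hom A B (fun a => cjoin (fun j => f j a))).
  move=> K u s /supremums_cjoin ->; apply/supremumsP => y; split.
    move=> /cjoinP h k; apply/cjoinP => j; apply: le_trans (h j).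
    by apply: ohom_le; exact: cjoin_ub.
  move=> h; apply/cjoinP => j; rewrite ohom_cjoin; apply/cjoinP => k.
  by apply: le_trans (h k); exact: (cjoin_ub (fun j => f j (u k))).
move=> K k0 u m um; apply/infimumsP => b; split.
  move=> bm k; apply: (le_trans bm); apply/cjoinP => j.
  apply: le_trans (cjoin_ub _ j); apply: ohom_le.
  by apply: ((infimumsP _ _).1 um m).1.
move=> h; set c := cjoin _.
have bt : b <= cjoin (fun j => f j \top).
  apply: (le_trans (h k0)); apply/cjoinP => j.
  by apply: le_trans (cjoin_ub _ j); apply: ohom_le; exact: lex1.
rewrite -(meet_idPl bt) meetC cjoin_meet; apply/cjoinP => i.
apply: le_trans (cjoin_ub _ i).
have /infimumsP fi := ohom_meet (f i) k0 um.
apply/fi => k /=; rewrite meetC.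
apply: (le_trans (leI2 (h k) (lexx _))).
rewrite /= cjoin_meet; apply/cjoinP => j.
have [->|ji] := eqVneq j i; first exact: leIl.
rewrite (@disj_le _ _ _ (f j \top) (f i \top)) ?D ?le0x //.
by apply: ohom_le; exact: lex1.
Defined.

Definition osum (A B : omegaBA) (J : countType) (f : J -> omegaBA_hom A B) :
    option (omegaBA_hom A B) :=
  if pselect (odisjoint f) is left D then Some (ojoin D) else None.

Section OmegaBAPam.
Variables A B : omegaBA.
Implicit Types (J K : countType) (s : omegaBA_hom A B).

Lemma osumP J (f : J -> omegaBA_hom A B) s :
  osum f = Some s <-> odisjoint f /\ forall a, s a = cjoin (fun j => f j a).
Proof.
rewrite /osum; case: pselect => D; last by split=> // -[].
split=> [[<-]//|[_ E]]; congr Some; apply: ohom_ext => a; by rewrite E.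
Qed.

Lemma osum_some J (f : J -> omegaBA_hom A B) : isSome (osum f) <-> odisjoint f.
Proof. by rewrite /osum; case: pselect. Qed.

Lemma osum_partition J K (p : J -> K) (x : J -> omegaBA_hom A B) s :
  osum x = Some s <->
  exists2 y : K -> omegaBA_hom A B,
    (forall k, osum (fun j : {j : J | p j == k} => x (val j)) = Some (y k)) &
    osum y = Some s.
Proof.
split.
  move=> /osumP[D sE].
  have Dk k : odisjoint (fun j : {j : J | p j == k} => x (val j)).
    by move=> i j ij; apply: D; move: ij; apply: ssrbool.contra => /eqP/val_inj ->.
  exists (fun k => ojoin (Dk k)); first by move=> k; apply/osumP.
  apply/osumP; split=> [k l kl|a]; last by rewrite sE (cjoin_partition p).
  apply: cjoin_disj => -[i /eqP pi] [j /eqP pj] /=; apply: D.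
  by move: kl; apply: ssrbool.contra => /eqP ij; rewrite -pi -pj ij.
move=> [y yP /osumP[D sE]].
have {}yP k := (osumP _ _).1 (yP k).
apply/osumP; split=> [i j ij|a]; last first.
  rewrite sE (cjoin_partition p); congr cjoin; apply: funext => k.
  exact: (yP k).2.
have [/eqP pij|pij] := eqVneq (p i) (p j).
  exact: ((yP (p j)).1 (exist _ i pij) (exist _ j (eqxx _)) ij).
have le j' : x j' \top <= y (p j') \top.
  rewrite (yP (p j')).2.
  exact: (cjoin_ub (fun i : {i | p i == p j'} => x (val i) \top) (exist _ j' (eqxx _))).
exact: disj_le (le i) (le j) (D _ _ pij).
Qed.

Lemma osum_unary J (x : J -> omegaBA_hom A B) j0 :
  (forall j, j = j0) -> osum x = Some (x j0).
Proof.
move=> H; apply/osumP; split=> [i j|a]; first by rewrite (H i) (H j) eqxx.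
by rewrite (cjoin_single _ H).
Qed.

Lemma osum_limit J (x : J -> omegaBA_hom A B) :
  (forall t : seq J, isSome (osum (fun j : {j : J | j \in t} => x (val j)))) ->
  isSome (osum x).
Proof.
move=> H; apply/osum_some => i j ij.
have /osum_some D := H [:: i; j].
have it : i \in [:: i; j] by rewrite inE eqxx.
have jt : j \in [:: i; j] by rewrite !inE eqxx orbT.
exact: (D (exist _ i it) (exist _ j jt) ij).
Qed.

Definition ozero : omegaBA_hom A B :=
  @ojoin A B void (of_void _) (fun i => match i with end).

Definition omegaBA_pam : sigmaPAM (omegaBA_hom A B) :=
  {| psum_inhabited := inhabits ozero;
     psum_partition := osum_partition;
     psum_unary := osum_unary;
     psum_limit := osum_limit |}.

Lemma opzeroE a : pzero (sigmaPAM_PCM omegaBA_pam) a = \bot.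
Proof.
have /osumP[_ ->] := svalP (psum_empty omegaBA_pam).
by apply: cjoin_void; case.
Qed.

Lemma oorthP f g :
  orth (sigmaPAM_PCM omegaBA_pam) f g <-> f \top `&` g \top = \bot.
Proof.
rewrite /orth /= osum_some; split=> [/(_ true false)->//|E].
by do 2 case=> //; rewrite // meetC.
Qed.

Lemma opaddP f g s :
  padd (sigmaPAM_PCM omegaBA_pam) f g = Some s <->
  f \top `&` g \top = \bot /\ forall a, s a = f a `|` g a.
Proof.
rewrite /= osumP; split=> -[D E]; split.
- exact: (D true false).
- by move=> a; rewrite E cjoin_bool.
- by do 2 case=> //; rewrite // meetC.
- by move=> a; rewrite E cjoin_bool.
Qed.

End OmegaBAPam.

Definition oprod (J : countType) (B : J -> omegaBA) : Type := forall j, B j.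

Section Oprod.
Variables (J : countType) (B : J -> omegaBA).
Local Notation T := (oprod B).
Implicit Types x y z : T.

HB.instance Definition _ := gen_eqMixin T.
HB.instance Definition _ := gen_choiceMixin T.

Let meetT x y : T := fun j => x j `&` y j.
Let joinT x y : T := fun j => x j `|` y j.

Let ext x y : (forall j, x j = y j) -> x = y.
Proof. exact: functional_extensionality_dep. Qed.

Let mC : commutative meetT. Proof. by move=> x y; apply: ext => j; apply: meetC. Qed.
Let jC : commutative joinT. Proof. by move=> x y; apply: ext => j; apply: joinC. Qed.
Let mA : associative meetT. Proof. by move=> x y z; apply: ext => j; apply: meetA. Qed.
Let jA : associative joinT. Proof. by move=> x y z; apply: ext => j; apply: joinA. Qed.
Let jKI y x : meetT x (joinT x y) = x. Proof. by apply: ext => j; apply: joinKI. Qed.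
Let mKU y x : joinT x (meetT x y) = x. Proof. by apply: ext => j; apply: meetKU. Qed.
Let mUl : left_distributive meetT joinT.
Proof. by move=> x y z; apply: ext => j; apply: meetUl. Qed.
Let mxx : idempotent_op meetT. Proof. by move=> x; apply: ext => j; apply: meetxx. Qed.

HB.instance Definition _ := @Order.isMeetJoinDistrLattice.Build
  (Order.Disp tt tt) T (fun x y => meetT x y == x)
  (fun x y => (y != x) && (meetT x y == x)) meetT joinT
  (fun _ _ => erefl) (fun _ _ => erefl) mC jC mA jA jKI mKU mUl mxx.

Lemma oprod_le x y : x <= y <-> forall j, x j <= y j.
Proof.
rewrite leEmeet; split=> [/eqP E j|H]; first by rewrite -E; exact: leIr.
by apply/eqP/ext => j; exact/meet_idPl.
Qed.

Let b0 x : ((fun j => \bot) : T) <= x. Proof. by apply/oprod_le => j; apply: le0x. Qed.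
Let t1 x : x <= ((fun j => \top) : T). Proof. by apply/oprod_le => j; apply: lex1. Qed.
HB.instance Definition _ := @Order.hasBottom.Build _ T _ b0.
HB.instance Definition _ := @Order.hasTop.Build _ T _ t1.

Let jC1 x : x `|` ((fun j => ~` x j) : T) = \top.
Proof. by apply: ext => j; apply: joinxC. Qed.
Let mC0 x : x `&` ((fun j => ~` x j) : T) = \bot.
Proof. by apply: ext => j; apply: meetxC. Qed.
HB.instance Definition _ := @Order.TBDistrLattice_hasComplement.Build _ T _ jC1 mC0.

Lemma oprod_sup (K : Type) (u : K -> T) (s : T) :
  supremums (range u) s <-> forall j, supremums (range (fun k => u k j)) (s j).
Proof.
split=> [/supremumsP H j|H]; apply/supremumsP => y; last first.
  split=> [/oprod_le sy k|uy]; apply/oprod_le => j.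
    by have /supremumsP/(_ (y j)) := H j => h; apply: h.1.
  by have /supremumsP/(_ (y j)) := H j => h; apply/h => k; exact: (oprod_le _ _).1 (uy k) j.
split=> [sy k|uy].
  apply: le_trans sy; have /oprod_le := (H s).1 (lexx s) k; exact.
pose y' : T := fun i => match i =P j with
  | ReflectT e => eq_rect_r (fun i => B i) y e | ReflectF _ => \top end.
have y'j : y' j = y.
  by rewrite /y'; case: eqP => // e; rewrite (Prop_irrelevance e erefl).
rewrite -y'j; apply: (oprod_le s y').1; apply/H => k; apply/oprod_le => i.
rewrite /y'; case: eqP => [e|_]; last exact: lex1.
by move: (e); rewrite e => e'; rewrite (Prop_irrelevance e' erefl) /=; apply: uy.
Qed.

End Oprod.

Lemma oprod_inf (J : countType) (B : J -> omegaBA) (K : Type) (u : K -> oprod B)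
    (s : oprod B) :
  infimums (range u) s <-> forall j, infimums (range (fun k => u k j)) (s j).
Proof.
split=> [/infimumsP H j|H]; apply/infimumsP => y; last first.
  split=> [/oprod_le sy k|uy]; apply/oprod_le => j.
    by have /infimumsP/(_ (y j)) := H j => h; apply: h.1.
  by have /infimumsP/(_ (y j)) := H j => h; apply/h => k; exact: (oprod_le _ _).1 (uy k) j.
split=> [sy k|uy].
  apply: (le_trans sy); have /oprod_le := (H s).1 (lexx s) k; exact.
pose y' : oprod B := fun i => match i =P j with
  | ReflectT e => eq_rect_r (fun i => B i) y e | ReflectF _ => \bot end.
have y'j : y' j = y.
  by rewrite /y'; case: eqP => // e; rewrite (Prop_irrelevance e erefl).
rewrite -y'j; apply: (oprod_le y' s).1; apply/H => k; apply/oprod_le => i.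
rewrite /y'; case: eqP => [e|_]; last exact: le0x.
by move: (e); rewrite e => e'; rewrite (Prop_irrelevance e' erefl) /=; apply: uy.
Qed.

Lemma oprod_join (J : countType) (B : J -> omegaBA) (K : countType)
  (u : K -> oprod B) : supremums (range u) !=set0.
Proof.
exists (fun j => cjoin (fun k => u k j)).
by apply/oprod_sup => j; exact: cjoin_sup.
Qed.

Definition oprodBA (J : countType) (B : J -> omegaBA) : omegaBA :=
  Build_omegaBA (@oprod_join J B).

Definition oproj (J : countType) (B : J -> omegaBA) (j : J) :
  omegaBA_hom (oprodBA B) (B j).
Proof.
apply: (@Build_omegaBA_hom (oprodBA B) (B j) (fun x => x j)) => [K u s us|K k0 u m um].
  exact: (oprod_sup _ _).1 us j.
exact: (oprod_inf _ _).1 um j.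
Defined.

Definition otuple (J : countType) (B : J -> omegaBA) (X : omegaBA)
  (f : forall j, omegaBA_hom X (B j)) : omegaBA_hom X (oprodBA B).
Proof.
apply: (@Build_omegaBA_hom X (oprodBA B) (fun x j => f j x)) => [K u s us|K k0 u m um].
  by apply/oprod_sup => j; exact: (ohom_join (f j)) us.
by apply/oprod_inf => j; exact: (ohom_meet (f j) k0) um.
Defined.

Lemma oprod_is_coproduct (J : countType) (B : J -> omegaBA) :
  @is_coproduct (opcat omegaBA_cat) J B (oprodBA B) (@oproj J B).
Proof.
move=> X f; exists (otuple f); split=> [j|h hE]; first exact: ohom_ext.
apply: ohom_ext => x /=; apply: functional_extensionality_dep => j.
by rewrite -hE.
Qed.

(* A coproduct in the opposite category is a product of algebras. *)
Definition omegaBA_coprod : countable_coproducts (opcat omegaBA_cat) :=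
  @Build_countable_coproducts (opcat omegaBA_cat) (@oprodBA) (@oproj)
    oprod_is_coproduct.

Definition omegaBA_op_pam (A B : opcat omegaBA_cat) : sigmaPAM (hom A B) :=
  omegaBA_pam B A.

Lemma omegaBA_comp_psumr (A B D : opcat omegaBA_cat) (g : hom B D)
    (J : countType) (f : J -> hom A B) (s : hom A B) :
  psum (omegaBA_op_pam A B) f = Some s ->
  psum (omegaBA_op_pam A D) (fun j => g ∘ f j) = Some (g ∘ s).
Proof.
move=> /osumP[Df sE]; apply/osumP; split=> [i j ij|a]; last exact: sE.
exact: (disj_le (ohom_le (f i) (lex1 (g \top))) (ohom_le (f j) (lex1 (g \top)))
               (Df i j ij)).
Qed.

Lemma omegaBA_comp_psuml (A B D : opcat omegaBA_cat) (f : hom A B)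
    (J : countType) (g : J -> hom B D) (s : hom B D) :
  psum (omegaBA_op_pam B D) g = Some s ->
  psum (omegaBA_op_pam A D) (fun j => g j ∘ f) = Some (s ∘ f).
Proof.
move=> /osumP[Dg sE]; apply/osumP; split=> [i j ij|a] /=.
  exact: ohom_disj (Dg i j ij).
by rewrite sE ohom_cjoin.
Qed.

Lemma omegaBA_compatible_sum (A B : opcat omegaBA_cat) (J : countType)
    (f : J -> hom A B) :
  compatible omegaBA_coprod omegaBA_op_pam (B := fun=> B) f ->
  summable (omegaBA_op_pam A B) f.
Proof.
move=> [h hP]; apply/osum_some => i j ij.
have [p [p1 p0] <-] := hP i; have [q [q1 q0] <-] := hP j.
apply: (@ohom_disj _ _ h (p \top) (q \top)).
apply: functional_extensionality_dep => k.
change (p \top k `&` q \top k = \bot).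
have [->|ki] := eqVneq k i.
  have := congr1 (fun r : omegaBA_hom B B => r \top) (q0 i ij) => /= ->.
  by rewrite opzeroE meetx0.
have := congr1 (fun r : omegaBA_hom B B => r \top) (p0 k ki) => /= ->.
by rewrite opzeroE meet0x.
Qed.

Lemma omegaBA_untying (A B : opcat omegaBA_cat) (f g : hom A B) :
  let kappa := coproj omegaBA_coprod (fun _ : bool => B) in
  orth (sigmaPAM_PCM (omegaBA_op_pam A B)) f g ->
  orth (sigmaPAM_PCM (omegaBA_op_pam A _)) (kappa true ∘ f) (kappa false ∘ g).
Proof. by move=> kappa /oorthP E; apply/oorthP. Qed.

Definition omegaBA_pac : sigmaPAC :=
  {| pac_coprod := omegaBA_coprod;
     pac_hom := omegaBA_op_pam;
     comp_psumr := omegaBA_comp_psumr;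
     comp_psuml := omegaBA_comp_psuml;
     compatible_sum := omegaBA_compatible_sum;
     untying := omegaBA_untying |}.

Lemma bool_join (J : countType) (u : J -> bool) : supremums (range u) !=set0.
Proof.
exists `[< exists j, u j >]; apply/supremumsP => y.
case: asboolP => [[j uj]|H]; split=> //.
- by move=> yt k; apply: le_trans yt; case: (u k).
- by move=> /(_ j); rewrite uj.
- by move=> _ k; case E : (u k) => //; case: H; exists k.
Qed.

Definition boolBA : omegaBA := Build_omegaBA bool_join.

Definition oelt (A : omegaBA) (a : A) : omegaBA_hom boolBA A.
Proof.
apply: (@Build_omegaBA_hom boolBA A (fun b : bool => if b then a else \bot)).
- move=> J u s /supremums_cjoin ->; apply/supremumsP => y.
  split=> [sy j|uy] /=.
    case uj : (u j); last exact: le0x.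
    by have := cjoin_ub u j; rewrite uj; move: sy; case: (cjoin u).
  have [[j uj]|H] := pselect (exists j, u j).
    by have := uy j; rewrite /= uj; case: ifP => // _ _; exact: le0x.
  have : (cjoin u : bool) <= false.
    by apply/(cjoinP u false) => j; case uj : (u j) => //; case: H; exists j.
  by case: (cjoin u : bool) => // _; exact: le0x.
- move=> J j0 u m /infimumsP um; apply/infimumsP => y.
  split=> [ym j|uy] /=.
    by have := (um m).1 (lexx m) j; case: m ym {um} => ym; case: (u j) => // _;
       apply: (le_trans ym); exact: le0x.
  case mE : m => /=.
    by apply: (le_trans (uy j0)) => /=; case: (u j0) => //; exact: le0x.
  have [[j uj]|H] := pselect (exists j, u j = false).
    by have := uy j; rewrite /= uj.
  have : true <= (m : bool).
    by apply/(um true) => j; case uj : (u j) => //; case: H; exists j.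
  by rewrite mE.
Defined.

Lemma oelt_top (A : omegaBA) (f : omegaBA_hom boolBA A) : f = oelt (f \top).
Proof. by apply: ohom_ext => -[] //=; exact: ohom0. Qed.

Definition omegaBA_one (A : omegaBA_pac) : hom A (boolBA : omegaBA_pac) :=
  oelt (\top : (A : omegaBA)).

Lemma omegaBA_effect (A : omegaBA_pac) :
  is_effect_algebra (hom_pcm A (boolBA : omegaBA_pac)) (omegaBA_one A).
Proof.
split=> [a|a /oorthP]; last first.
  rewrite /= meetx1 => a0; apply: ohom_ext => b.
  by rewrite opzeroE; case: b => //; exact: ohom0.
pose c : A := (a : omegaBA_hom boolBA A) \top.
exists (oelt (~` c)); split.
  apply/opaddP; split=> [|b]; first by rewrite /= meetxC.
  by case: b; rewrite /= ?joinxC // ohom0 joinx0.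
move=> b /opaddP[D E]; rewrite [b]oelt_top; congr oelt.
have Et := E true.
apply/esym/eqP; rewrite eq_le -disj_leC meetC D eqxx /=.
by rewrite -[~` c]meet1x meet_le_imp complK joinC -Et.
Qed.

Lemma omegaBA_zero (A B : omegaBA_pac) (f : hom A B) :
  omegaBA_one B ∘ f = zerom A (boolBA : omegaBA_pac) -> f = zerom A B.
Proof.
move=> /(congr1 (fun r : omegaBA_hom boolBA A => r \top)).
rewrite opzeroE /= => f1; apply: ohom_ext => b; rewrite opzeroE.
by apply/eqP; rewrite -lex0 -f1; apply: ohom_le; exact: lex1.
Qed.

Lemma omegaBA_orth (A B : omegaBA_pac) (f g : hom A B) :
  orth (hom_pcm A (boolBA : omegaBA_pac)) (omegaBA_one B ∘ f) (omegaBA_one B ∘ g) ->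
  orth (hom_pcm A B) f g.
Proof. by move=> /oorthP E; apply/oorthP. Qed.

Definition omegaBA_op : sigmaEffectus :=
  {| eff_effect := omegaBA_effect;
     eff_zero := omegaBA_zero;
     eff_orth := omegaBA_orth |}.

(* Main.v *)
(* The functor sends A to the powerset of its nonzero substates and f to the
   preimage operation of the partial map w |-> f ∘ w.  Since a nonzero scalar
   is 1, any nonzero component of a substate of a coproduct carries all of its
   mass: a nonzero substate of a coproduct factors through exactly one
   coprojection, so coproducts go to disjoint unions, i.e. to products of
   powersets. *)

From mathcomp Require Import all_boot all_order.
From mathcomp Require Import boolp classical_sets.
Require Import Defs.

Set Implicit Arguments.
Unset Strict Implicit.
Unset Printing Implicit Defensive.

Import Order.Theory SetOrder.Exports.

Local Open Scope classical_set_scope.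
Local Open Scope order_scope.
Local Open Scope cat_scope.

(** * Sums of families that vanish off a subset *)

Section SumSupport.
Variables (M : Type) (S : sigmaPAM M).
Let zero := pzero (sigmaPAM_PCM S).

Lemma psum_empty_index (J : countType) (x : J -> M) :
  (J -> False) -> psum S x = Some zero.
Proof.
move=> J0; pose phi (v : void) : J := of_void _ v.
have bphi : bijective phi by exists (fun j => False_rect _ (J0 j)) => [[]|j]; case: (J0 j).
rewrite -(psum_reindex _ _ bphi) (_ : x \o phi = of_void M) ?(svalP (psum_empty S)) //.
by apply: funext; case.
Qed.

(** Partition [J] along [p]: each fibre is a singleton or empty, and an empty fibre sums to zero, so
    the fibre sums of [x \o p] form the family [x]. *)
Lemma psum_support (J K : countType) (p : J -> K) (x : K -> M) :
  injective p -> (forall k, (forall j, p j <> k) -> x k = zero) ->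
  psum S x = psum S (x \o p).
Proof.
move=> pI x0.
have fib k : psum S (fun j : {j | p j == k} => (x \o p) (val j)) = Some (x k).
  have [[j pj]|pk] := pselect (exists j, p j = k).
    have jP : p j == k by apply/eqP.
    rewrite (@psum_unary _ S _ _ (exist _ j jP)) /= ?pj //.
    by case=> i iP; apply/val_inj/pI; rewrite /= pj (eqP iP).
  rewrite (x0 k) => [|j pj]; last by apply: pk; exists j.
  by apply: psum_empty_index => -[j /eqP pj]; apply: pk; exists j.
have H s : psum S (x \o p) = Some s <-> psum S x = Some s.
  split=> [/(psum_partition S p) [y yP <-]|xs].
    by congr psum; apply: funext => k; apply: Some_inj; rewrite -fib yP.
  by apply/(psum_partition S p); exists x.
case E : (psum S x) => [s|]; first by apply/esym/H.
by case E' : (psum S _) => [s|//]; move/H: E'; rewrite E.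
Qed.

Lemma psum_zero (J : countType) : psum S (fun _ : J => zero) = Some zero.
Proof.
have vI : injective (of_void J) by case.
by rewrite (psum_support vI) // psum_empty_index //; case.
Qed.

Lemma psum_single (J : countType) (x : J -> M) (j0 : J) :
  (forall j, j != j0 -> x j = zero) -> psum S x = Some (x j0).
Proof.
move=> x0; rewrite (@psum_support unit J (fun=> j0)).
- by apply: psum_unary tt _; case.
- by case; case.
- by move=> j /(_ tt) /eqP j0j; apply: x0; rewrite eq_sym.
Qed.

(** Splitting [J] into [j0] and the rest, the complement [b] is the sum over the rest. *)
Lemma psum_padd (J : countType) (x : J -> M) (j0 : J) (s : M) :
  psum S x = Some s -> exists b, padd (sigmaPAM_PCM S) (x j0) b = Some s.
Proof.
move=> /(psum_partition S (fun j => j == j0)) [y yP ys]; exists (y false).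
have y1 : y true = x j0.
  apply: Some_inj; rewrite -yP.
  have j0P : (j0 == j0) == true by rewrite eqxx.
  rewrite (@psum_unary _ S _ _ (exist _ j0 j0P)) //.
  by case=> j jP; apply: val_inj => /=; move: jP => /eqP/eqP.
by rewrite /= -ys; congr psum; apply: funext; case; rewrite // -y1.
Qed.

End SumSupport.

Lemma comp_zeror (C : sigmaPAC) (A B D : C) (g : hom B D) :
  g ∘ zerom A B = zerom A D.
Proof.
have := comp_psumr g (svalP (psum_empty (pac_hom A B))).
by rewrite psum_empty_index => [[]|[]].
Qed.

Lemma comp_zerol (C : sigmaPAC) (A B D : C) (f : hom A B) :
  zerom B D ∘ f = zerom A D.
Proof.
have := comp_psuml f (svalP (psum_empty (pac_hom B D))).
by rewrite psum_empty_index => [[]|[]].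
Qed.

(** * Partial projections and the decomposition of the identity of a coproduct *)

Section Coproduct.
Variables (C : sigmaPAC) (J : countType) (B : J -> C) (P : C).
Variable kappa : forall j, hom (B j) P.
Hypothesis kappaP : is_coproduct kappa.

Lemma coproduct_ext (X : C) (g h : hom P X) :
  (forall j, g ∘ kappa j = h ∘ kappa j) -> g = h.
Proof.
move=> E; have [m [_ mU]] := kappaP (fun j => h ∘ kappa j).
by rewrite -(mU g E) -(mU h (fun=> erefl)).
Qed.

Lemma pproj_exists (j : J) :
  {p : hom P (B j) | p ∘ kappa j = idm (B j) &
    forall k, k != j -> p ∘ kappa k = zerom (B k) (B j)}.
Proof.
apply: cid2.
(* The Kronecker delta family; [k = j] is only propositional, so the identity is transported along
   it. *)
pose f k : hom (B k) (B j) :=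
  if k =P j is ReflectT e then eq_rect_r (fun i => hom (B i) (B j)) (idm (B j)) e
  else zerom (B k) (B j).
have [p [pE _]] := kappaP f; exists p => [|k kj]; rewrite pE /f.
  by case: eqP => // e; rewrite (Prop_irrelevance e erefl).
by case: eqP kj.
Qed.

Definition pproj (j : J) : hom P (B j) := s2val (pproj_exists j).

Lemma pproj_id j : pproj j ∘ kappa j = idm (B j).
Proof. exact: s2valP (pproj_exists j). Qed.

Lemma pproj_zero j k : k != j -> pproj j ∘ kappa k = zerom (B k) (B j).
Proof. exact: s2valP' (pproj_exists j) k. Qed.

End Coproduct.

Section Decomposition.
Variables (C : sigmaPAC) (J : countType) (B : J -> C) (P : C).
Variable kappa : forall j, hom (B j) P.
Hypothesis kappaP : is_coproduct kappa.

(* The family kappa_j ∘ pproj_j is compatible via the map P -> coprod_j P whose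
   j-th component is the j-th coprojection after kappa_j. *)
Lemma psum_coproduct_id :
  psum (pac_hom P P) (fun j => kappa j ∘ pproj kappaP j) = Some (idm P).
Proof.
pose cP := coprodP (pac_coprod C) (B := fun _ : J => P).
pose q j : hom P _ := coproj (pac_coprod C) (fun _ : J => P) j.
pose p j : hom _ P := pproj cP j.
have p_id j : p j ∘ q j = idm P := pproj_id cP j.
have p_zero i j : i != j -> p j ∘ q i = zerom P P := @pproj_zero _ _ _ _ _ cP j i.
have : summable (pac_hom P P) (fun j => kappa j ∘ pproj kappaP j).
  have [h [hE _]] := kappaP (fun j => q j ∘ kappa j).
  apply: compatible_sum; exists h => j; exists (p j).
    by split=> [|i ij]; [exact: p_id|exact: p_zero].
  apply: (coproduct_ext kappaP) => i; rewrite -!compA hE compA.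
  have [->|ij] := eqVneq i j; first by rewrite p_id pproj_id comp1m compm1.
  by rewrite p_zero // pproj_zero // comp_zerol comp_zeror.
rewrite /summable; case E : (psum _ _) => [s|//] _; congr Some.
(* The sum is the identity because, after precomposition with [kappa k], only the [k]-th term
   survives. *)
apply: (coproduct_ext kappaP) => k; rewrite comp1m; apply: Some_inj.
rewrite -(comp_psuml (kappa k) E) (psum_single (j0 := k)).
  by rewrite -compA pproj_id compm1.
by move=> j jk; rewrite -compA pproj_zero 1?eq_sym // comp_zeror.
Qed.

End Decomposition.

(** * Nonzero substates over two-valued scalars *)

Section BooleanScalars.
Variable C : sigmaEffectus.
Let I := eff_I C.
Hypothesis scalars2 : em_isomorphic (scalars C) two_em.

Lemma scalar_neq10 : eff_one I <> zerom I I.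
Proof.
have [phi [_ phi0 phi1 _ _]] := scalars2.
by move=> /(congr1 phi); rewrite [LHS]phi1 [RHS]phi0.
Qed.

Lemma scalar_nonzero (s : hom I I) : s <> zerom I I -> s = eff_one I.
Proof.
have [phi [/bij_inj phiI phi0 phi1 _ _]] := scalars2; move=> s0.
apply: (phiI); rewrite [RHS]phi1; case E : (phi s) => //.
by case: s0; apply: phiI; rewrite E [RHS]phi0.
Qed.

Lemma one_nonzero_substate (A : C) (w : substate A) :
  w <> zerom I A -> eff_one A ∘ w = eff_one I.
Proof. by move=> w0; apply: scalar_nonzero => /eff_zero. Qed.

(** A nonzero [a] already has mass 1, so the mass of [b] is orthogonal to 1, hence zero, and [b]
    vanishes. *)
Lemma substate_component (A : C) (w a b : substate A) :
  padd (hom_pcm I A) a b = Some w -> a <> zerom I A -> w = a.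
Proof.
move=> E a0.
have b0 : b = zerom I A.
  apply/eff_zero/(eff_effect I).2; rewrite -(one_nonzero_substate a0).
  by rewrite /orth paddC (comp_paddr (eff_one A) E).
by move: E; rewrite b0 paddC padd0 => -[].
Qed.

Section CoproductSubstates.
Variables (J : countType) (B : J -> C) (P : C) (kappa : forall j, hom (B j) P).
Hypothesis kappaP : is_coproduct kappa.

(** Since [w] is the sum of its components [kappa j ∘ pproj kappaP j ∘ w], some component is
    nonzero, and that one equals [w]. *)
Lemma coproduct_substate (w : substate P) :
  w <> zerom I P -> exists j (t : substate (B j)), w = kappa j ∘ t.
Proof.
move=> w0; apply: contrapT => H; apply: w0.
have := comp_psuml w (psum_coproduct_id kappaP); rewrite comp1m => E.
suff Z j : (kappa j ∘ pproj kappaP j) ∘ w = zerom I P.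
  by move: E; rewrite (funext Z) psum_zero => -[].
apply: contrapT => j0; apply: H; exists j, (pproj kappaP j ∘ w).
have [b bE] := psum_padd j E.
by rewrite compA; apply: substate_component bE j0.
Qed.

Lemma coproj_inj j (A : C) (s t : hom A (B j)) :
  kappa j ∘ s = kappa j ∘ t -> s = t.
Proof.
by move=> /(congr1 (comp (pproj kappaP j))); rewrite !compA pproj_id !comp1m.
Qed.

Lemma coproj_disjoint j k (A : C) (s : hom A (B j)) (t : hom A (B k)) :
  kappa j ∘ s = kappa k ∘ t -> s <> zerom A (B j) -> k = j.
Proof.
move=> E s0; apply/eqP/negPn/negP => kj; apply: s0.
move: E => /(congr1 (comp (pproj kappaP j))).
by rewrite !compA pproj_id pproj_zero // comp1m comp_zerol.
Qed.

End CoproductSubstates.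

End BooleanScalars.

(** * Powerset algebras and preimages under partial maps *)

Lemma supremums_set (T : Type) (J : Type) (u : J -> set T) (s : set T) :
  supremums (range u) s <-> forall t, s t <-> exists j, u j t.
Proof.
split=> [/supremumsP H t|H].
  split=> [st|[j ujt]]; last first.
    by have := (H s).1 (lexx s) j; rewrite subsetEset; apply.
  have : s <= [set t | exists j, u j t].
    by apply/H => j; rewrite subsetEset => a uja; exists j.
  by rewrite subsetEset; apply.
apply/supremumsP => y; rewrite subsetEset; split=> [sy j|uy t /H [j]].
  by rewrite subsetEset => t ujt; apply/sy/H; exists j.
by move: (uy j); rewrite subsetEset; apply.
Qed.

Lemma infimums_set (T : Type) (J : Type) (u : J -> set T) (s : set T) :
  infimums (range u) s <-> forall t, s t <-> forall j, u j t.
Proof.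
split=> [/infimumsP H t|H].
  split=> [st j|ut].
    by have := (H s).1 (lexx s) j; rewrite subsetEset; apply.
  have : [set t | forall j, u j t] <= s.
    by apply/H => j; rewrite subsetEset => a; apply.
  by rewrite subsetEset; apply.
apply/infimumsP => y; rewrite subsetEset; split=> [sy j|uy t yt].
  by rewrite subsetEset => t /sy /H.
by apply/H => j; move: (uy j); rewrite subsetEset; apply.
Qed.

Lemma powerset_join (T : Type) (J : countType) (u : J -> set T) :
  supremums (range u) !=set0.
Proof. by exists [set t | exists j, u j t]; apply/supremums_set. Qed.

Definition powersetBA (T : Type) : omegaBA := Build_omegaBA (@powerset_join T).

(** A partial map is encoded as a functional relation; the preimage of the top is its domain of
    definition, which may be proper. *)
Definition preimage_hom (T U : Type) (r : T -> U -> Prop)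
    (rF : forall t a b, r t a -> r t b -> a = b) :
  omegaBA_hom (powersetBA U) (powersetBA T).
Proof.
apply: (@Build_omegaBA_hom (powersetBA U) (powersetBA T)
  (fun V => [set t | exists2 a, V a & r t a])) => [J u s|J j0 u m].
  move=> /supremums_set sE; apply/supremums_set => t; split.
    by move=> [a /sE[j uja] ra]; exists j, a.
  by move=> [j [a uja ra]]; exists a => //; apply/sE; exists j.
move=> /infimums_set mE; apply/infimums_set => t; split.
  by move=> [a /mE ma ra] j; exists a => //; exact: ma.
(* The index [j0] provides a value of the partial map at [t]; functionality makes the witnesses for
   all other [j] equal to it. *)
move=> H; have [a _ ra] := H j0; exists a => //; apply/mE => j.
by have [b ujb /rF/(_ ra) <-] := H j.
Defined.

(** * The state functor *)

Section StateFunctor.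
Variable C : sigmaEffectus.
Let I := eff_I C.

(** Zero is excluded so that [f ∘ w = 0] means that the partial map induced by [f] is undefined at
    [w]. *)
Definition state (A : C) : Type := {w : substate A | w <> zerom I A}.

Definition mk_state (A : C) (w : substate A) (w0 : w <> zerom I A) : state A :=
  exist _ w w0.

Lemma state_inj (A : C) (s t : state A) : sval s = sval t -> s = t.
Proof. by case: s t => s s0 [t t0] /=; exact: eq_exist. Qed.

Lemma state_image_uniq (A B : C) (f : hom A B) (s : state A) (a b : state B) :
  sval a = f ∘ sval s -> sval b = f ∘ sval s -> a = b.
Proof. by move=> aE bE; apply: state_inj; rewrite aE bE. Qed.

Definition state_pullback (A B : C) (f : hom A B) :
    @hom omegaBA_op (powersetBA (state A)) (powersetBA (state B)) :=
  preimage_hom (@state_image_uniq A B f).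

Lemma state_pullback1 (A : C) :
  state_pullback (idm A) = @idm omegaBA_op (powersetBA (state A)).
Proof.
apply: ohom_ext => V; apply/seteqP; split=> s /=.
  by move=> [a Va]; rewrite comp1m => /state_inj <-.
by exists s; rewrite ?comp1m.
Qed.

Lemma state_pullbackM (A B D : C) (g : hom B D) (f : hom A B) :
  state_pullback (g ∘ f) = state_pullback g ∘ state_pullback f.
Proof.
apply: ohom_ext => V; apply/seteqP; split=> s /=.
  move=> [a Va aE].
  (* The intermediate value must itself be a state: were it zero, so would be its image [a] under
     [g]. *)
  have fs0 : f ∘ sval s <> zerom I B.
    move=> E; apply: (proj2_sig a).
    by rewrite aE -compA E comp_zeror.
  by exists (mk_state fs0) => //; exists a; rewrite //= aE compA.
by move=> [b [a Va aE] bE]; exists a; rewrite // aE bE compA.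
Qed.

Definition state_functor : functor C omegaBA_op :=
  {| fmap1 := state_pullback1; fmapM := state_pullbackM |}.

Lemma state_functor_faithful : substate_separated C -> faithful state_functor.
Proof.
move=> sep A B f g E; apply: sep.
(* The preimage of a singleton detects every nonzero value [f' ∘ w]. Used in both directions, this
   leaves only the case where both values are zero. *)
have sub (f' g' : hom A B) w : state_pullback f' = state_pullback g' ->
    f' ∘ w <> zerom I B -> g' ∘ w = f' ∘ w.
  move=> E' fw0.
  have w0 : w <> zerom I A by move=> wE; apply: fw0; rewrite wE comp_zeror.
  pose t : state B := mk_state fw0; pose s : state A := mk_state w0.
  have : state_pullback f' [set t] s by exists t.
  by rewrite E' => -[_ ->].
move=> w; have [fw0|fw0] := pselect (f ∘ w = zerom I B); last exact/esym/sub.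
have [gw0|gw0] := pselect (g ∘ w = zerom I B); first by rewrite fw0 gw0.
exact: sub (esym E) gw0.
Qed.

Hypothesis scalars2 : em_isomorphic (scalars C) two_em.

Lemma state_functor_coproducts : preserves_countable_coproducts state_functor.
Proof.
move=> J B P kappa kappaP X f.
(* Chooses for each state of [P] a coprojection and a state through which it factors; [decK] shows
   that this choice is forced. *)
have dec (s : state P) :
    {x : {j : J & state (B j)} | sval s = kappa (tag x) ∘ sval (tagged x)}.
  apply: cid; have [j [t tE]] := coproduct_substate scalars2 kappaP (proj2_sig s).
  have t0 : t <> zerom I (B j).
    by move=> E; apply: (proj2_sig s); rewrite tE E comp_zeror.
  by exists (existT _ j (exist _ t t0)).
have decK j (t : state (B j)) (s : state P) :
    sval s = kappa j ∘ sval t -> sval (dec s) = existT _ j t.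
  case: (dec s) => -[k t'] /= -> E.
  have jk := coproj_disjoint kappaP E (proj2_sig t'); subst k.
  by congr existT; apply/state_inj/(coproj_inj kappaP E).
(* The mediating map: a state lies in [hf x] when its factor, in summand [j], lies in [f j x]. *)
pose hf (x : (X : omegaBA)) : powersetBA (state P) :=
  [set s | (f (tag (sval (dec s))) x : set _) (tagged (sval (dec s)))].
have hf_join (K : countType) (u : K -> X : omegaBA) z :
    supremums (range u) z -> supremums (range (hf \o u)) (hf z).
  move=> uz; apply/supremums_set => t.
  by have /supremums_set/(_ (tagged (sval (dec t)))) :=
    ohom_join (f (tag (sval (dec t)))) uz.
have hf_meet (K : countType) (k0 : K) (u : K -> X : omegaBA) z :
    infimums (range u) z -> infimums (range (hf \o u)) (hf z).
  move=> uz; apply/infimums_set => t.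
  by have /infimums_set/(_ (tagged (sval (dec t)))) :=
    ohom_meet (f (tag (sval (dec t)))) k0 uz.
exists (Build_omegaBA_hom hf_join hf_meet); split=> [j|h hE].
  apply: ohom_ext => x; apply/seteqP; split=> s /=.
    by move=> [a + /decK]; rewrite /hf /= => + E; rewrite E.
  move=> fs.
  have ks0 : kappa j ∘ sval s <> zerom I P.
    by move=> E; apply: (proj2_sig s); apply: (coproj_inj kappaP); rewrite E comp_zeror.
  exists (mk_state ks0) => //.
  by move: (@decK j s (mk_state ks0) erefl); rewrite /hf /= => ->.
apply: ohom_ext => x; apply/seteqP; split=> s; rewrite /= /hf /=.
  rewrite -hE => -[a hxa aE].
  by rewrite (state_inj (etrans (svalP (dec s)) (esym aE))).
by move=> hxs; rewrite -hE; exists s => //; exact: svalP (dec s).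
Qed.

Lemma state_functor_unit :
  exists2 u : hom (eff_I omegaBA_op) (state_functor I), is_iso u &
    forall A : C, fmap state_functor (eff_one A) = u ∘ eff_one (state_functor A).
Proof.
pose s1 : state I := mk_state (scalar_neq10 scalars2).
have sE (s : state I) : s = s1.
  exact/state_inj/(scalar_nonzero scalars2)/(proj2_sig s).
(* The scalar 1 is the only state of [I], so membership of it identifies the powerset with the
   two-element algebra. *)
pose ev (V : powersetBA (state I)) : boolBA := `[< (V : set _) s1 >].
have leb (b c : bool) : b <= c <-> (b -> c) by case: b; case: c; split=> // /(_ isT).
have ev_join (J : countType) (V : J -> powersetBA (state I)) W :
    supremums (range V) W -> supremums (range (ev \o V)) (ev W).
  move=> /supremums_set WE; apply/supremumsP => b; split.
    by move=> /leb Wb j; apply/leb => /asboolP Vj; apply/Wb/asboolP/WE; exists j.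
  by move=> Vb; apply/leb => /asboolP/WE[j Vj]; apply: (leb _ _).1 (Vb j) _; apply/asboolP.
have ev_meet (J : countType) (j0 : J) (V : J -> powersetBA (state I)) W :
    infimums (range V) W -> infimums (range (ev \o V)) (ev W).
  move=> /infimums_set WE; apply/infimumsP => b; split.
    by move=> /leb bW j; apply/leb => /bW/asboolP/WE Wj; apply/asboolP/Wj.
  by move=> bV; apply/leb => bT; apply/asboolP/WE => j; apply/asboolP/(leb _ _).1/bT/bV.
pose u : @hom omegaBA_op boolBA (powersetBA (state I)) :=
  Build_omegaBA_hom ev_join ev_meet.
exists u.
  exists (oelt (\top : powersetBA (state I))); split; apply: ohom_ext.
    by case; apply/asboolP.
  move=> V; apply/seteqP; split=> s; rewrite (sE s) /= /ev; case: asboolP => //.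
(* Every state of [A] has mass 1, so both sides send [V] to all states if [s1] lies in [V], and to
   the empty set otherwise. *)
move=> A; apply: ohom_ext => V; apply/seteqP; split=> s /=; rewrite /ev.
  by case=> a Va _; move: Va; rewrite (sE a) => Va; rewrite asboolT.
case: asboolP => // Vs1 _; exists s1 => //=.
by rewrite one_nonzero_substate //; exact: proj2_sig s.
Qed.

End StateFunctor.

Theorem theorem50 (C : sigmaEffectus) :
  substate_separated C ->
  em_isomorphic (scalars C) two_em ->
  exists G : functor C omegaBA_op, is_effectus_morphism G /\ faithful G.
Proof.
move=> sep scalars2; exists (state_functor C).
split; last exact: state_functor_faithful.
by split; [exact: state_functor_coproducts|exact: state_functor_unit].
Qed.
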